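(* Suppose that the convex operator $\rho(\cdot)$ is stable and proper. Then for a given $\xi\in L^{4p}_{\mathcal{F}}(\mathbb{P})$ and a sub $\sigma$-algebra $\mathcal{C}$ of $\mathcal{F}$, there exists a $\hat\eta\in L^{2p}_{\mathcal{C}}(\mathbb{P})$ such that $$\rho\big((\xi-\hat\eta)^2\big)=\inf_{\eta\in L^{2p}_{\mathcal{C}}(\mathbb{P})}\rho\big((\xi-\eta)^2\big).$$
   Context: $(\Omega,\mathcal{F},\mathbb{P})$ is a probability space, $1<p\le2$, $\frac1p+\frac1q=1$. For a sub $\sigma$-algebra $\mathcal{G}$ of $\mathcal{F}$, $L^r_{\mathcal{G}}(\mathbb{P})$ is the set of $r$-th power $\mathbb{P}$-integrable $\mathcal{G}$-measurable random variables. $\mathcal{M}$ is the set of probability measures absolutely continuous with respect to $\mathbb{P}$; for $P\in\mathcal{M}$, $f^P=dP/d\mathbb{P}$, and $f^P_{\mathcal{C}}=\mathbb{E}[f^P|\mathcal{C}]$ ($\mathbb{E}$ is expectation under $\mathbb{P}$, $E_P$ under $P$). A convex operator is a map $\rho:L^p_{\mathcal{F}}(\mathbb{P})\to\mathbb{R}$ that is monotone ($\xi_1\ge\xi_2$ implies $\rho(\xi_1)\ge\rho(\xi_2)$), constant invariant ($\rho(\xi+c)=\rho(\xi)+c$ for $c\in\mathbb{R}$) and convex; throughout it is normalized: $\rho(0)=0$. Put $\mathcal{A}_\rho=\{\zeta\in L^p_{\mathcal{F}}(\mathbb{P}):\rho(\zeta)\le0\}$, $\alpha(P)=\sup_{\zeta\in\mathcal{A}_\rho}E_P[\zeta]$,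 and the representation set $\mathcal{P}=\{P\in\mathcal{M}: f^P\in L^q_{\mathcal{F}}(\mathbb{P}),\ \alpha(P)<\infty\}$; $\mathcal{D}=\{f^P:P\in\mathcal{P}\}$. The following facts, quoted in the paper from the literature, are standing: $\rho(\xi)=\sup_{P\in\mathcal{P}}[E_P[\xi]-\alpha(P)]$ for all $\xi\in L^p_{\mathcal{F}}(\mathbb{P})$; $\mathcal{D}$ is norm-bounded in $L^q_{\mathcal{F}}(\mathbb{P})$ and $\sigma(L^q_{\mathcal{F}}(\mathbb{P}),L^p_{\mathcal{F}}(\mathbb{P}))$-compact; $\mathcal{P}$ is convex. $\rho$ is stable if for every $P\in\mathcal{P}$ and every sub $\sigma$-algebra $\mathcal{C}$ of $\mathcal{F}$, $f^P/f^P_{\mathcal{C}}\in\mathcal{D}$. $\rho$ is proper if every element of $\mathcal{P}$ is equivalent to $\mathbb{P}$. *)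

(* Defs.v *)
From HB Require Import structures.
From mathcomp Require Import all_boot all_order all_algebra.
From mathcomp Require Import all_classical all_reals all_analysis.

Set Implicit Arguments.
Unset Strict Implicit.
Unset Printing Implicit Defensive.

Import Order.TTheory GRing.Theory Num.Theory.
Import numFieldNormedType.Exports.

Local Open Scope classical_set_scope.
Local Open Scope ring_scope.
Local Open Scope charge_scope.

(* Random variables are functions T -> R rather than almost-sure classes, and
   C-measurability is taken with respect to C itself, not its P-completion.
   An operator rho is a total function of which only the restriction to
   L^p(P) matters; monotonicity, stated almost surely, makes that restriction
   well defined on almost-sure classes. *)

Definition is_sub_sigma_algebra d (T : measurableType d) (C : set (set T)) :
    Prop :=
  sigma_algebra [set: T] C /\ C `<=` measurable.

Section random_variables.
Context d (T : measurableType d) (R : realType) (P : probability T R).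

Definition sub_measurable (C : set (set T)) (f : T -> R) : Prop :=
  measurable_fun [set: g_sigma_algebraType C]
    (f : g_sigma_algebraType C -> R).

Definition Lsub (C : set (set T)) (r : R) : set (T -> R) :=
  [set f | f \in Lfun P r%:E /\ sub_measurable C f].

(* g is a version of the conditional expectation of f given C under P *)
Definition is_cond_exp (C : set (set T)) (f g : T -> R) : Prop :=
  [/\ sub_measurable C g,
      P.-integrable [set: T] (EFin \o g) &
      forall A, C A ->
        (\int[P]_(x in A) (g x)%:E = \int[P]_(x in A) (f x)%:E)%E].

(* dQ/dP; only meaningful when Q `<< P *)
Definition density (Q : probability T R) : T -> R :=
  fun x => fine (('d (charge_of_finite_measure Q) '/d P) x).

(* The duality bracket of L^q and L^p, curried. The initial topology it induces
   on functions f, restricted to L^q, is sigma(L^q, L^p). Two functions that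
   agree almost surely are not separated by it, so that a set saturated under
   almost sure equality is compact for it iff its image among almost-sure
   classes is compact for the usual weak topology. *)
Definition pairing (p : R) (f : T -> R) :
    {ptws {zeta : T -> R | zeta \in Lfun P p%:E} -> R} :=
  fun zeta => Rintegral P [set: T] (fun x => f x * sval zeta x).

Definition weakly_compact (p : R) (D : set (T -> R)) : Prop :=
  compact (D : set (initial_topology (@pairing p))).

Definition norm_bounded (q : R) (D : set (T -> R)) : Prop :=
  exists M : R, forall f, D f -> ('N[P]_q%:E[EFin \o f] <= M%:E)%E.

End random_variables.

Definition prob_convex d (T : measurableType d) (R : realType)
    (S : set (probability T R)) : Prop :=
  forall (Q1 Q2 Q : probability T R) (t : R), S Q1 -> S Q2 -> 0 <= t <= 1 ->
    (forall A, measurable A ->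
      (Q A = t%:E * Q1 A + (1 - t)%:E * Q2 A)%E) ->
    S Q.

Record convex_operator d (T : measurableType d) (R : realType)
    (P : probability T R) (p : R) (rho : (T -> R) -> R) : Prop := {
  convex_operator_mono : forall xi1 xi2 : T -> R,
    xi1 \in Lfun P p%:E -> xi2 \in Lfun P p%:E ->
    {ae P, forall x, xi2 x <= xi1 x} -> rho xi2 <= rho xi1 ;
  convex_operator_cst : forall (xi : T -> R) (c : R),
    xi \in Lfun P p%:E -> rho (fun x => xi x + c) = rho xi + c ;
  convex_operator_convex : forall (xi1 xi2 : T -> R) (t : R),
    xi1 \in Lfun P p%:E -> xi2 \in Lfun P p%:E -> 0 <= t <= 1 ->
    rho (fun x => t * xi1 x + (1 - t) * xi2 x)
      <= t * rho xi1 + (1 - t) * rho xi2 ;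
  convex_operator_normalized : rho (fun=> 0) = 0
}.

Section representation.
Context d (T : measurableType d) (R : realType) (P : probability T R).
Variables (p q : R) (rho : (T -> R) -> R).

Definition acceptance_set : set (T -> R) :=
  [set zeta | zeta \in Lfun P p%:E /\ rho zeta <= 0].

Definition penalty (Q : probability T R) : \bar R :=
  ereal_sup [set ('E_Q[zeta])%E | zeta in acceptance_set].

Definition representation_set : set (probability T R) :=
  [set Q : probability T R | [/\ Q `<< P, density P Q \in Lfun P q%:E &
      (penalty Q < +oo)%E]].

(* saturated under almost sure equality *)
Definition density_set : set (T -> R) :=
  [set f | f \in Lfun P q%:E /\
     exists2 Q, representation_set Q & {ae P, forall x, f x = density P Q x}].

Definition dual_representation : Prop :=
  forall xi : T -> R, xi \in Lfun P p%:E ->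
    (rho xi)%:E =
      ereal_sup [set ('E_Q[xi] - penalty Q)%E | Q in representation_set].

(* By saturation of density_set the choice of the version fC is immaterial. *)
Definition stable_operator : Prop :=
  forall Q : probability T R, representation_set Q ->
  forall C : set (set T), is_sub_sigma_algebra C ->
  forall fC : T -> R, is_cond_exp P C (density P Q) fC ->
    density_set (fun x => density P Q x / fC x).

Definition proper_operator : Prop :=
  forall Q : probability T R, representation_set Q -> Q `<< P /\ P `<< Q.

End representation.

(* Main.v *)
Require Import Defs.
From HB Require Import structures.
From mathcomp Require Import all_boot all_order all_algebra.
From mathcomp Require Import all_classical all_reals all_analysis.
From mathcomp Require Import measurable_realfun ring lra.
Import Order.TTheory GRing.Theory Num.Theory.
Import numFieldNormedType.Exports.
Local Open Scope classical_set_scope.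
Local Open Scope ring_scope.

Set Implicit Arguments.
Unset Strict Implicit.
Unset Printing Implicit Defensive.

(** Write <f,X> for the integral of f X under P, D for the set of densities, A
    for the acceptance set, alpha(f) for the supremum of <f,zeta> over zeta in
    A, and L(eta,f) = <f,(xi - eta)^2> - alpha(f). The dual representation reads
    rho((xi - eta)^2) = sup of L(eta,f) over f in D, so that a minimizer is the
    first component of a saddle point of L. The saddle point is built directly,
    without a minimax theorem.

    For one density f, the best square estimator of xi given C under f P is the
    conditional mean eta_f = E[f xi|C] / E[f|C]. By conditional Jensen,
    |eta_f|^(2p) is at most the conditional mean of |xi|^(2p) under the density
    f / E[f|C]. Stability puts f / E[f|C] in D, hence in L^q, while |xi|^(2p) is
    in L^p because 2 p^2 <= 4 p; therefore eta_f is in L^(2p)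
    ([estimator_Lsub]). It minimizes L(-,f) over L^(2p) of C
    ([estimator_minimal]).

    Let S be the supremum over f in D of the infimum over eta of L(eta,f). This
    infimum is also the infimum over eta and zeta in A of
    <f,(xi - eta)^2 - zeta>, an infimum of weakly continuous functions of f;
    by weak compactness S is attained at some fhat ([dual_maximizer]). Put
    etahat = eta_fhat and perturb fhat towards an arbitrary f in D:
    f_t = t f + (1 - t) fhat lies in D, with optimal estimator eta_t. As L is
    concave in its second argument,
      S >= L(eta_t,f_t) >= t L(eta_t,f) + (1 - t) L(eta_t,fhat)
        >= t L(eta_t,f) + (1 - t) S,
    whence L(eta_t,f) <= S. When t tends to 0, eta_t tends pointwise to etahat,
    being the quotient of the mixtures of E[f xi|C], E[fhat xi|C] and of E[f|C],
    E[fhat|C], and Fatou's lemma gives L(etahat,f) <= S ([saddle]). Hence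
    rho((xi - etahat)^2) <= S <= L(eta,fhat) <= rho((xi - eta)^2) for every
    admissible eta ([minimizer_exists]).

    Properness makes densities positive almost everywhere, so they and their
    conditional expectations can be replaced by versions that are positive
    everywhere; the quotients above then need no exceptional set. *)

(** * Lebesgue spaces *)

Section inequalities.
Context (R : realType).

Lemma mul_norm_powR (e r : R) : 2 <= r -> e * `|e| `^ (r - 2) * e = `|e| `^ r.
Proof.
move=> r2; have [->|e0] := eqVneq e 0.
  by rewrite mulr0 normr0 powR0// gt_eqF// (lt_le_trans _ r2).
have -> : `|e| `^ r = `|e| `^ 2 * `|e| `^ (r - 2).
  by rewrite -powRD ?normr_eq0 ?e0 ?implybT// subrKC.
by rewrite powR_mulrn// real_normK ?num_real// mulrAC -expr2.
Qed.

(** Young's inequality for |x| and |e|^(r-1), in the signed form that replaces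
    Jensen's inequality for the r-th power: multiplied by a density and
    integrated, its left side becomes an r-th moment of e when e is the
    conditional mean of x. *)
Lemma young_powRB2 (e x r : R) : 2 <= r ->
  e * `|e| `^ (r - 2) * x <= r^-1 * `|x| `^ r + (1 - r^-1) * `|e| `^ r.
Proof.
move=> r2; have r0 : 0 < r by exact: lt_le_trans r2.
have r1 : 1 < r by move: r2; lra.
apply: le_trans (ler_norm _) _; rewrite !normrM (ger0_norm (powR_ge0 _ _)).
rewrite mulrC -[X in _ * (X * _)]powRr1// -powRD; last first.
  apply/implyP => /eqP h; exfalso; lra.
rewrite (_ : 1 + (r - 2) = r - 1); last by ring.
have h0 : 0 < r / (r - 1) by rewrite divr_gt0// subr_gt0.
have hr : r^-1 + (r / (r - 1))^-1 = 1.
  by rewrite invf_div mulrBl mul1r divff ?gt_eqF//; ring.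
have := conjugate_powR (normr_ge0 x) (powR_ge0 `|e| (r - 1)) r0 h0 hr.
rewrite -powRrM mulrCA divff ?gt_eqF ?subr_gt0// mulr1.
have -> : 1 - r^-1 = (r / (r - 1))^-1 by move: hr; lra.
by rewrite mulrC [r^-1 * _]mulrC [(r / _)^-1 * _]mulrC.
Qed.

End inequalities.

Lemma measurable_inv_pos d (T : measurableType d) (R : realType) (h : T -> R) :
  (forall x, 0 < h x) -> measurable_fun [set: T] h ->
  measurable_fun [set: T] (fun x => (h x)^-1).
Proof.
move=> h0 mh; under eq_fun do rewrite -powR_inv1 ?ltW//.
exact: (measurableT_comp (measurable_powR (-1))).
Qed.

Section Lebesgue_spaces.
Context d (T : measurableType d) (R : realType) (P : probability T R).

Lemma Lfun_measurable (f : T -> R) (r : \bar R) :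
  f \in Lfun P r -> measurable_fun [set: T] f.
Proof. by rewrite inE => /andP[/[!inE]]. Qed.

Lemma LfunP_integrable (f : T -> R) (r : R) : 1 <= r ->
  f \in Lfun P r%:E <->
  measurable_fun [set: T] f /\
  P.-integrable [set: T] (fun x => (`|f x| `^ r)%:E).
Proof.
move=> r1; split => [fr|[mf /integrableP[_ fr]]].
  by split; [exact: Lfun_measurable fr|exact: Lfun_integrable].
rewrite inE; apply/andP; split; rewrite inE//= /finite_norm unlock /Lnorm.
apply: poweR_lty; apply: le_lt_trans fr.
by under [leRHS]eq_integral do rewrite /= ger0_norm ?powR_ge0//.
Qed.

(** The duality bracket of L^q and L^p converges, by Hoelder. *)
Lemma integrable_mul_Lfun (f g : T -> R) (p q : R) :
  0 < p -> 0 < q -> p^-1 + q^-1 = 1 ->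
  f \in Lfun P q%:E -> g \in Lfun P p%:E ->
  P.-integrable [set: T] (EFin \o (f \* g)).
Proof.
move=> p0 q0 pq fq gp; rewrite addrC in pq.
have mf := Lfun_measurable fq; have mg := Lfun_measurable gp.
apply/integrableP; split; first exact/measurable_EFinP/measurable_funM.
have := hoelder P mf mg q0 p0 pq; rewrite Lnorm1 => /le_lt_trans; apply.
rewrite lte_mul_pinfty ?Lnorm_ge0 ?ge0_fin_numE ?Lnorm_ge0//.
- by move: fq; rewrite inE => /andP[_]; rewrite inE.
- by move: gp; rewrite inE => /andP[_]; rewrite inE.
Qed.

Lemma Lfun_powR (f : T -> R) (a b : R) : 1 <= a -> 1 <= b ->
  f \in Lfun P (a * b)%:E -> (fun x => `|f x| `^ a) \in Lfun P b%:E.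
Proof.
move=> a1 b1 /LfunP_integrable[|mf If].
  by rewrite -[1]mulr1 ler_pM.
apply/LfunP_integrable => //; split.
  by apply: (measurableT_comp (measurable_powR a)); exact: measurableT_comp.
apply: eq_integrable If => // x _.
by rewrite /= powRrM [X in _ = (X `^ b)%:E]ger0_norm ?powR_ge0.
Qed.

Lemma Lfun_sqr (f : T -> R) (p : R) : 1 <= p ->
  f \in Lfun P (2 * p)%:E -> (fun x => f x ^+ 2) \in Lfun P p%:E.
Proof.
move=> p1 /Lfun_powR; move=> /(_ _ p1).
under eq_fun do rewrite powR_mulrn// real_normK ?num_real//.
by apply; rewrite ler1n.
Qed.

Lemma LfunB (f g : T -> R) (p : R) : 1 <= p ->
  f \in Lfun P p%:E -> g \in Lfun P p%:E ->
  (fun x => f x - g x) \in Lfun P p%:E.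
Proof.
move=> p1 fp gp; have p1' : (1 <= p%:E)%E by rewrite lee_fin.
have [_ addc] := Lfun_addr_closed P p1'.
have oppc : - g \in Lfun P p%:E by exact: Lfun_oppr_closed.
exact: (addc _ _ fp oppc).
Qed.

Lemma LfunS (f : T -> R) (p r : R) : 1 <= p -> p <= r ->
  f \in Lfun P r%:E -> f \in Lfun P p%:E.
Proof.
move=> p1 pr; apply: Lfun_subset; rewrite ?lee_fin ?(le_trans p1)//.
exact: fin_num_measure.
Qed.

(** Fatou's lemma in the form in which every limit below is taken: a uniform
    bound on the integrals passes to the almost sure limit, so that no
    domination or monotonicity has to be checked. *)
Lemma fatou_le (u : nat -> T -> R) (v : T -> R) (c : \bar R) :
  (forall n, measurable_fun [set: T] (u n)) -> measurable_fun [set: T] v ->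
  (forall n, {ae P, forall x, 0 <= u n x}) ->
  {ae P, forall x, u ^~ x @ \oo --> v x} ->
  (forall n, \int[P]_x (u n x)%:E <= c)%E -> (\int[P]_x (v x)%:E <= c)%E.
Proof.
move=> mu mv u0 uv uc.
pose w n x : \bar R := (`|u n x|)%:E.
have mw n : measurable_fun [set: T] (w n).
  by apply/measurable_EFinP; exact: measurableT_comp.
have -> : (\int[P]_x (v x)%:E = \int[P]_x limn_einf (w ^~ x))%E.
  apply: ae_eq_integral => //.
  - exact/measurable_EFinP.
  - rewrite /limn_einf; apply: measurableT_comp => //.
    by apply: measurable_fun_limn_esup => n; exact: measurableT_comp.
  - have u0' : {ae P, forall x n, 0 <= u n x} by exact: ae_foralln.
    apply: filterS2 u0' uv => x ux uvx _.
    have cw : w ^~ x @ \oo --> (v x)%:E.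
      rewrite (_ : w ^~ x = fun n => (u n x)%:E); last first.
        by apply/funext => n; rewrite /w ger0_norm.
      by apply/fine_cvgP; split; [exact: nearW|exact: uvx].
    by have [-> _] := cvg_limn_einf_sup cw.
have w0 n x : [set: T] x -> (0 <= w n x)%E by rewrite lee_fin.
apply: (le_trans (fatou P measurableT mw w0)).
have wc n : (\int[P]_x w n x <= c)%E.
  apply: le_trans (uc n); rewrite le_eqVlt; apply/orP; left; apply/eqP.
  apply: ae_eq_integral => //; first exact/measurable_EFinP.
  by apply: filterS (u0 n) => x ux _; rewrite /w ger0_norm.
rewrite limn_einf_lim; apply: lime_le; first exact: is_cvg_einfs.
apply: nearW => n; apply: ge_ereal_inf.
by exists (\int[P]_x w n x)%E => //; exists n => /=.
Qed.
Lemma EFin_Rintegral (u : T -> R) : P.-integrable [set: T] (EFin \o u) ->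
  (\int[P]_x (u x)%:E)%E = (\int[P]_x u x)%:E.
Proof. by move=> iu; rewrite fineK//; exact: integrable_fin_num. Qed.

Lemma integrable_bounded_mul (u b : T -> R) (M : R) :
  P.-integrable [set: T] (EFin \o u) -> measurable_fun [set: T] b ->
  (forall x, `|b x| <= M) -> P.-integrable [set: T] (EFin \o (b \* u)).
Proof.
move=> iu mb bM.
apply: (@le_integrable _ _ _ _ _ measurableT _ (fun x => (M%:E * (u x)%:E)%E)).
- apply/measurable_EFinP/measurable_funM => //.
  by apply/measurable_EFinP; exact: measurable_int iu.
- move=> x _ /=; rewrite lee_fin !normrM ler_wpM2r//.
  by rewrite (le_trans (bM x)) ?ler_norm.
- exact: integrableZl.
Qed.

Lemma Lfun_ae_eq (f g : T -> R) (r : R) : 1 <= r ->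
  measurable_fun [set: T] g -> {ae P, forall x, g x = f x} ->
  f \in Lfun P r%:E -> g \in Lfun P r%:E.
Proof.
move=> r1 mg gf /LfunP_integrable[//|mf /integrableP[mfr ifr]].
have mp (h : T -> R) : measurable_fun [set: T] h ->
    measurable_fun [set: T] (fun x => (`|h x| `^ r)%:E).
  move=> mh; apply/measurable_EFinP.
  apply: (measurableT_comp (measurable_powR r)).
  exact: measurableT_comp.
apply/LfunP_integrable => //; split => //.
apply/integrableP; split; first exact: mp.
rewrite (ae_eq_integral (fun x => `|(`|f x| `^ r)%:E|)%E)//.
- by apply: measurableT_comp => //; exact: mp.
- by apply: measurableT_comp => //; exact: mp.
- by apply: filterS gf => x -> _.
Qed.

Lemma ae_eq_Rintegral (f g : T -> R) :
  measurable_fun [set: T] f -> measurable_fun [set: T] g ->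
  {ae P, forall x, f x = g x} -> \int[P]_x f x = \int[P]_x g x.
Proof.
move=> mf mg fg; congr fine; apply: ae_eq_integral => //.
- exact/measurable_EFinP.
- exact/measurable_EFinP.
- by apply: filterS fg => x -> _.
Qed.

End Lebesgue_spaces.

(** * Conditional expectation *)

Section cond_exp.
Context d (T : measurableType d) (R : realType) (P : probability T R).
Variables (C : set (set T)) (hC : is_sub_sigma_algebra C).
Local Notation TC := (g_sigma_algebraType C).

Lemma sub_sigma_measurableE : (measurable : set (set TC)) = C.
Proof. exact: (sigma_algebra_id hC.1). Qed.

Lemma sub_sigma_in (A : set TC) : measurable A -> C A.
Proof. by rewrite sub_sigma_measurableE. Qed.

Lemma sub_sigma_measurable (A : set TC) :
  measurable A -> d.-measurable (A : set T).
Proof. by move=> mA; apply: hC.2; rewrite -sub_sigma_measurableE. Qed.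

Lemma measurable_to_sub : measurable_fun [set: T] (id : T -> TC).
Proof.
move=> _ A mA; rewrite setTI preimage_id; exact: sub_sigma_measurable.
Qed.

Lemma sub_measurableW (f : T -> R) :
  sub_measurable C f -> measurable_fun [set: T] f.
Proof. by move=> mf; apply: (measurableT_comp mf measurable_to_sub). Qed.

(** Push P and the signed measure u P forward along the identity map to the
    coarser measurable space carried by C; the Radon-Nikodym derivative there is
    C-measurable by construction. *)
Lemma cond_exp_exists (u : T -> R) : P.-integrable [set: T] (EFin \o u) ->
  exists g, is_cond_exp P C u g.
Proof.
move=> iu.
pose j : {mfun T >-> TC} := HB.pack (id : T -> TC)
  (isMeasurableFun.Build _ _ _ _ _ measurable_to_sub).
pose PC := distribution P j.
pose nu_ : {charge set TC -> \bar R} := pushforward (induced_charge iu) j.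
pose nu := nu_ measurable_to_sub.
have null (A : set T) : d.-measurable A -> P A = 0%E ->
    (\int[P]_(x in A) (u x)%:E = 0)%E.
  move=> mA PA0; apply: null_set_integral => //.
  by apply: measurable_funTS; exact: measurable_int iu.
have nuPC : nu `<< PC.
  apply/null_content_dominatesP => A mA PA0; apply: null => //.
  exact: sub_sigma_measurable.
pose g := fine \o (Radon_Nikodym nu PC).
have gE : EFin \o g = (Radon_Nikodym nu PC).
  by apply/funext => x /=; rewrite fineK// Radon_Nikodym_fin_num.
have ig := Radon_Nikodym_integrable nuPC.
rewrite -gE in ig.
have mg : measurable_fun [set: TC] g.
  by apply/measurable_EFinP; exact: measurable_int ig.
have igP : P.-integrable [set: T] (EFin \o g).
  apply/integrableP; split; first exact/measurable_EFinP/sub_measurableW.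
  have /integrableP[_] := ig.
  by rewrite ge0_integral_pushforward//; do 2 apply: measurableT_comp => //.
exists g; split => // A CA.
have mA : measurable (A : set TC) by rewrite sub_sigma_measurableE.
rewrite -[RHS]/(nu A) (Radon_Nikodym_integral nuPC mA) -gE.
rewrite (@integral_pushforward _ _ T TC R j measurable_to_sub P A (EFin \o g)) //.
- exact/measurable_EFinP.
- by apply: integrableS igP => //; apply: hC.2; rewrite preimage_id.
Qed.

Import HBNNSimple.

(** By linearity, orthogonality to the indicators of C extends to C-measurable
    simple functions. *)
Lemma integral_sfun_mul_eq0 (h : {nnsfun TC >-> R}) (v : T -> R) :
  P.-integrable [set: T] (EFin \o v) ->
  (forall A, C A -> (\int[P]_(x in A) (v x)%:E = 0)%E) ->
  (\int[P]_x (h x * v x)%:E = 0)%E.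
Proof.
move=> iv v0.
have mh y : measurable (h @^-1` [set y] : set T).
  by apply: sub_sigma_measurable; exact: measurable_sfunP.
transitivity (\int[P]_x (\sum_(y <- finmap.enum_fset (fset_set (range h)))
    (y%:E * ((EFin \o v) \_ (h @^-1` [set y])) x))%E)%E.
  apply: eq_integral => x _; rewrite fimfunE fsbig_finite//= mulr_suml -sumEFin.
  apply: eq_bigr => y _; rewrite -mulrA EFinM; congr (_ * _)%E.
  by rewrite epatch_indic/= -EFinM mulrC.
rewrite integral_sum//.
  rewrite big1// => y _; rewrite integralZl//.
    rewrite -integral_mkcond v0 ?mule0//.
    by apply: sub_sigma_in; exact: measurable_sfunP.
  by apply/(integrable_mkcond _ (mh y)); exact: integrableS iv.
move=> y; apply: integrableZl => //.
by apply/(integrable_mkcond _ (mh y)); exact: integrableS iv.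
Qed.

(** The difference u - g integrates to 0 over the sets of C, hence against
    C-measurable simple functions, hence against bounded C-measurable functions
    by dominated convergence. *)
Lemma cond_exp_pullout (u g b : T -> R) (M : R) :
  P.-integrable [set: T] (EFin \o u) -> is_cond_exp P C u g ->
  sub_measurable C b -> (forall x, `|b x| <= M) ->
  \int[P]_x (b x * u x) = \int[P]_x (b x * g x).
Proof.
move=> iu [mg ig gE] mb bM.
pose v : T -> R := u \- g.
have iv : P.-integrable [set: T] (EFin \o v).
  exact: (integrableB measurableT iu ig).
have v0 A : C A -> (\int[P]_(x in A) (v x)%:E = 0)%E.
  move=> CA; have mA := hC.2 _ CA.
  rewrite integralB_EFin//; [|exact: integrableS iu|exact: integrableS ig].
  rewrite gE// subee//; apply: integrable_fin_num => //; exact: integrableS iu.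
have mbT := sub_measurableW mb.
(* Simple functions approximate nonnegative functions from below; the shift by
   M makes b nonnegative and costs nothing, as u - g has mean 0. *)
pose w := (fun x => b x + M) : TC -> R.
have w0 x : 0 <= w x.
  by rewrite -lerBlDr sub0r; have := bM x; rewrite ler_norml => /andP[].
have mw : measurable_fun [set: TC] (EFin \o w).
  by apply/measurable_EFinP; apply: measurable_funD.
pose h := nnsfun_approx measurableT mw.
have hw n x : h n x <= w x.
  rewrite -lee_fin nnsfun_approxE; apply: le_approx => // y _.
  by rewrite lee_fin.
have w2M x : w x <= M + M.
  by rewrite lerD2r; exact: le_trans (ler_norm _) (bM x).
have wv0 : (\int[P]_x (w x * v x)%:E = 0)%E.
  have cv : (\int[P]_x (h n x * v x)%:E)%E @[n --> \oo] -->
      (\int[P]_x (w x * v x)%:E)%E.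
    apply: (@dominated_cvg _ _ _ _ _ measurableT _ _
      (fun x => ((M + M) * `|v x|)%:E)).
    - move=> n; apply/measurable_EFinP/measurable_funM.
        by apply: sub_measurableW; exact: measurable_funP.
      by apply/measurable_EFinP; exact: measurable_int iv.
    - move=> x _; under eq_fun do rewrite EFinM; rewrite EFinM.
      apply: cvgeZr => //; apply: (cvg_nnsfun_approx measurableT mw) => //.
      by move=> y _; rewrite lee_fin.
    - by [].
    - apply: (eq_integrable measurableT
        (fun x => ((M + M)%:E * `|(v x)%:E|)%E)) => //.
      by apply: integrableZl => //; exact: integrable_abse.
    - move=> n x _ /=; rewrite lee_fin normrM ler_wpM2r// ger0_norm//.
      exact: le_trans (hw n x) (w2M x).
  rewrite -(cvg_lim _ cv)//; under eq_fun do rewrite integral_sfun_mul_eq0//.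
  by rewrite lim_cst.
have ib (z : T -> R) : P.-integrable [set: T] (EFin \o z) ->
   P.-integrable [set: T] (EFin \o (b \* z)).
  by move=> iz; exact: (integrable_bounded_mul iz mbT bM).
apply/eqP; rewrite -subr_eq0 -RintegralB//; try exact: ib.
apply/eqP; move: wv0.
have -> : (fun x => (w x * v x)%:E) =
    (fun x => (b x * u x - b x * g x)%:E + M%:E * (v x)%:E)%E.
  by apply/funext => x; rewrite -EFinM -EFinD; congr EFin; rewrite /w /v /=; ring.
rewrite integralD//.
- rewrite integralZl// v0 ?mule0 ?adde0 /Rintegral => [->|] //.
  exact: sub_sigma_in.
- exact: (integrableB measurableT (ib _ iu) (ib _ ig)).
- exact: integrableZl.
Qed.
Lemma cond_exp_comb (u v g h : T -> R) (s t : R) :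
  P.-integrable [set: T] (EFin \o u) -> P.-integrable [set: T] (EFin \o v) ->
  is_cond_exp P C u g -> is_cond_exp P C v h ->
  is_cond_exp P C (fun x => s * u x + t * v x) (fun x => s * g x + t * h x).
Proof.
move=> iu iv [mg ig gE] [mh ih hE]; split.
- by apply: measurable_funD; apply: measurable_funM => //; exact: measurable_cst.
- exact: (integrableD measurableT (integrableZl measurableT s ig)
    (integrableZl measurableT t ih)).
move=> A CA; have mA := hC.2 _ CA.
have iA (z : T -> R) : P.-integrable [set: T] (EFin \o z) ->
    P.-integrable A (EFin \o z).
  by apply: integrableS.
have comb (y z : T -> R) :
    P.-integrable A (EFin \o y) -> P.-integrable A (EFin \o z) ->
    (\int[P]_(x in A) (s * y x + t * z x)%:E =
     s%:E * \int[P]_(x in A) (y x)%:E + t%:E * \int[P]_(x in A) (z x)%:E)%E.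
  by move=> iy iz; rewrite -!integralZl// -integralD//; exact: integrableZl.
by rewrite !comb; try exact: iA; rewrite gE// hE.
Qed.

(** On the set of C where a version is nonpositive, u has a nonpositive
    integral; since u is positive, this set is negligible, and the version can be
    set to 1 there. *)
Lemma cond_exp_pos_exists (u : T -> R) :
  P.-integrable [set: T] (EFin \o u) -> (forall x, 0 < u x) ->
  exists2 g, is_cond_exp P C u g & forall x, 0 < g x.
Proof.
move=> iu u0; have [g [mg ig gE]] := cond_exp_exists iu.
have mA : measurable ([set x | g x <= 0] : set TC).
  by rewrite -[X in measurable X]setTI; apply: measurable_fun_le.
set A := [set x | g x <= 0] in mA.
have CA : C A by exact: sub_sigma_in.
have mAT := hC.2 _ CA.
have iuA := integrableS measurableT mAT (@subsetT _ _) iu.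
have intA : (\int[P]_(x in A) (u x)%:E = 0)%E.
  apply/eqP; rewrite eq_le; apply/andP; split.
    have igA := integrableS measurableT mAT (@subsetT _ _) ig.
    rewrite -gE// -[leRHS](integral0 P A); apply: le_integral => //.
      exact: integrable0.
    by move=> x /set_mem; rewrite /A /= lee_fin.
  by apply: integral_ge0 => x _; rewrite lee_fin ltW.
have nA : {ae P, forall x, ~ A x}.
  have /(ae_eq_integral_abs P mAT (measurable_int _ iuA)) :
      (\int[P]_(x in A) `|(u x)%:E| = 0)%E.
    rewrite -[RHS]intA; apply: eq_integral => x _.
    by rewrite gee0_abs// lee_fin ltW.
  apply: filterS => x uA Ax; have /= := uA Ax; case=> ux0.
  by have := u0 x; rewrite ux0 ltxx.
pose h x := if g x <= 0 then 1 else g x.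
have mh : sub_measurable C h.
  by apply: measurable_fun_ifT => //; apply: measurable_fun_ler.
have mhT := sub_measurableW mh.
have hg : {ae P, forall x, (h x)%:E = (g x)%:E}.
  by apply: filterS nA => x; rewrite /A /h /=; case: (leP (g x) 0).
exists h; last first.
  by move=> x; rewrite /h; case: (leP (g x) 0) => // _; exact: ltr01.
split => //.
  apply/integrableP; split; first exact/measurable_EFinP.
  have /integrableP[_] := ig; rewrite (ae_eq_integral (abse \o (EFin \o h)))//.
  - apply: measurableT_comp => //; exact: measurable_int ig.
  - by apply: measurableT_comp => //; exact/measurable_EFinP.
  - by apply: filterS hg => x [gx] _; rewrite /= gx.
move=> B CB; rewrite -gE//; have mB := hC.2 _ CB; apply: ae_eq_integral => //.
- by apply: measurable_funTS; exact/measurable_EFinP.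
- by apply: measurable_funTS; exact: measurable_int ig.
- by apply: filterS hg => x gx _.
Qed.

End cond_exp.

(** * The conditional mean of a density *)

Section estimator.
Context d (T : measurableType d) (R : realType) (P : probability T R).
Variables (C : set (set T)) (hC : is_sub_sigma_algebra C).
Local Notation TC := (g_sigma_algebraType C).

Variables (p q : R) (p1 : 1 < p) (q0 : 0 < q) (pq : p^-1 + q^-1 = 1).
Variables (f xi fC kC : T -> R).
Hypotheses (fq : f \in Lfun P q%:E) (f0 : forall x, 0 < f x).
Hypotheses (fCE : is_cond_exp P C f fC) (fC0 : forall x, 0 < fC x).
Hypothesis (kCE : is_cond_exp P C (f \* xi) kC).
Hypotheses (xi2p : xi \in Lfun P (2 * p)%:E).

Let p0 : 0 < p. Proof. exact: lt_trans p1. Qed.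
Let p1' : 1 <= p. Proof. exact: ltW. Qed.
Let eta x := kC x / fC x.

Lemma estimator_measurable : sub_measurable C eta.
Proof.
have [mf _ _] := fCE; have [mk _ _] := kCE.
by apply: measurable_funM => //; exact: measurable_inv_pos.
Qed.

(** [cond_exp_pullout] together with the integrability needed to manipulate its
    left side. *)
Let pullout_bounded (b : T -> R) M (z zC : T -> R) : sub_measurable C b ->
  (forall x, `|b x| <= M) -> P.-integrable setT (EFin \o z) ->
  is_cond_exp P C z zC ->
  P.-integrable setT (EFin \o (b \* z)) /\
  \int[P]_x (b x * z x) = \int[P]_x (b x * zC x).
Proof.
move=> mb bM iz zCE; split; last exact: (cond_exp_pullout hC iz zCE mb bM).
by apply: (integrable_bounded_mul iz _ bM); exact: (sub_measurableW hC).
Qed.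

Let f_integrable : P.-integrable setT (EFin \o f).
Proof.
have := integrable_mul_Lfun p0 q0 pq fq (Lfun_cst P 1 p).
by under [X in P.-integrable _ (_ \o X)]eq_fun do rewrite /= mulr1.
Qed.

Let fxi_integrable : P.-integrable setT (EFin \o (f \* xi)).
Proof.
apply: integrable_mul_Lfun p0 q0 pq fq _.
by apply: LfunS xi2p => //; rewrite ler_peMl ?ler1n// ltW.
Qed.

(** Pythagoras: the cross term <f,(xi - eta)(eta - eta')> vanishes since
    eta - eta' is C-measurable. Pulling this factor out needs it to be
    bounded, so the computation takes place on the sets A n of C where eta and
    eta' are at most n in absolute value, and Fatou's lemma lets n grow. *)
Lemma estimator_minimal (eta' : T -> R) : eta \in Lfun P (2 * p)%:E ->
  Lsub P C (2 * p) eta' ->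
  \int[P]_x (f x * (xi x - eta x) ^+ 2) <=
  \int[P]_x (f x * (xi x - eta' x) ^+ 2).
Proof.
move=> Leta [Leta' meta'].
have p21 : 1 <= 2 * p by move: p1'; lra.
have isq (z : T -> R) : z \in Lfun P (2 * p)%:E ->
    P.-integrable setT (EFin \o (fun x => f x * (xi x - z x) ^+ 2)).
  move=> Lz.
  apply: (@integrable_mul_Lfun _ _ _ P f (fun x => (xi x - z x) ^+ 2) p q) => //.
  by apply: Lfun_sqr => //; exact: LfunB.
have meta := estimator_measurable.
pose A n : set TC := [set x | `|eta x| <= n%:R] `&` [set x | `|eta' x| <= n%:R].
have mA n : measurable (A n).
  by apply: measurableI; rewrite -[X in measurable X]setTI;
    apply: measurable_fun_le => //; exact: measurableT_comp.
pose b n x := (\1_(A n) x * (eta x - eta' x)) : R.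
have mb n : sub_measurable C (b n).
  apply: measurable_funM; first exact: measurable_indic.
  exact: (measurable_funB meta meta').
have mbe n : sub_measurable C (fun x => b n x * eta x).
  exact: (measurable_funM (mb n) meta).
have bM n x : `|b n x| <= n%:R + n%:R.
  rewrite /b indicE; case: (boolP (x \in A n)) => [/set_mem[/= a1 a2]|_].
    rewrite mul1r; apply: (le_trans (ler_normB _ _)). exact: lerD.
  by rewrite mul0r normr0 addr_ge0.
have beM n x : `|b n x * eta x| <= (n%:R + n%:R) * n%:R.
  have := bM n x; rewrite /b indicE.
  case: (boolP (x \in A n)) => [/set_mem[/= a1 a2]|_].
    by rewrite mul1r normrM => h; apply: ler_pM.
  by rewrite !mul0r normr0 mulr_ge0// addr_ge0.
have main n : (\int[P]_x (\1_(A n) x * (f x * (xi x - eta x) ^+ 2))%:E <=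
     (\int[P]_x (f x * (xi x - eta' x) ^+ 2))%:E)%E.
  have [i1 e1] := pullout_bounded (mb n) (bM n) fxi_integrable kCE.
  have [i2 e2] := pullout_bounded (mbe n) (beM n) f_integrable fCE.
  have e12 : \int[P]_x (b n x * eta x * fC x) = \int[P]_x (b n x * kC x).
    by congr Rintegral; apply/funext => x; rewrite -mulrA /eta divfK// gt_eqF.
  have iA : P.-integrable setT
      (EFin \o (fun x => \1_(A n) x * (f x * (xi x - eta x) ^+ 2))).
    apply: (integrable_bounded_mul (isq _ Leta) (M := 1)).
      by apply: (sub_measurableW hC); exact: measurable_indic.
    by move=> x; rewrite indicE; case: (x \in A n); rewrite ?normr1 ?normr0.
  rewrite EFin_Rintegral// lee_fin.
  (* Subtracting twice the cross term leaves the integral unchanged and makes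
     the comparison pointwise. *)
  apply: (@le_trans _ _ (\int[P]_x (f x * (xi x - eta' x) ^+ 2 -
      2 * (b n x * (f x * xi x) - b n x * eta x * f x)))).
    have i3 := integrableB measurableT i1 i2.
    have i4 := integrableZl measurableT 2 i3.
    have i5 := integrableB measurableT (isq _ Leta') i4.
    apply: le_Rintegral => //.
    move=> x _; rewrite /b indicE; case: (boolP (x \in A n)) => [_|_] /=.
      rewrite !mul1r -subr_ge0.
      rewrite (_ : _ - _ = f x * (eta x - eta' x) ^+ 2); last by ring.
      by rewrite mulr_ge0 ?sqr_ge0 ?ltW.
    by rewrite !mul0r subrr mulr0 subr0 mulr_ge0 ?sqr_ge0 ?ltW.
  have i3 : P.-integrable setT
      (EFin \o (fun x => b n x * (f x * xi x) - b n x * eta x * f x)).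
    exact: (integrableB measurableT i1 i2).
  rewrite RintegralB//; last exact: (integrableZl measurableT 2 i3).
    rewrite RintegralZl// RintegralB// e1 e2 e12 subrr mulr0 subr0//.
  exact: isq.
have le : (\int[P]_x (f x * (xi x - eta x) ^+ 2)%:E <=
     (\int[P]_x (f x * (xi x - eta' x) ^+ 2))%:E)%E.
  apply: fatou_le main.
  - move=> n; apply: measurable_funM.
      by apply: (sub_measurableW hC); exact: measurable_indic.
    by apply/measurable_EFinP; exact: measurable_int (isq _ Leta).
  - by apply/measurable_EFinP; exact: measurable_int (isq _ Leta).
  - move=> n; apply: aeW => x; apply: mulr_ge0; first by rewrite indicE ler0n.
    by rewrite mulr_ge0 ?sqr_ge0// ltW.
  - apply: aeW => x; apply: cvg_near_cst.
    near=> n; rewrite indicE mem_set ?mul1r//; split => /=; near: n.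
      exact: nbhs_infty_ger.
    exact: nbhs_infty_ger.
by move: le; rewrite EFin_Rintegral ?lee_fin//; exact: isq.
Unshelve. all: by end_near.
Qed.

(** Conditional Jensen for the power r = 2p. Let I be the r-th moment of eta on
    A n and J the integral of |xi|^r f / fC. Since eta is the conditional mean of
    xi for the density f / fC, I is also the integral of
    eta |eta|^(r-2) xi f / fC on A n, and Young's inequality bounds it by
    J / r + (1 - 1/r) I; thus I <= J. The truncation to A n makes I finite and
    the test functions b1 and b2 bounded, and is removed by Fatou's lemma. *)
Lemma estimator_Lsub : (fun x => f x / fC x) \in Lfun P q%:E ->
  (fun x => `|xi x| `^ (2 * p)) \in Lfun P p%:E -> Lsub P C (2 * p) eta.
Proof.
move=> gq xip.
have meta := estimator_measurable.
have metaT := sub_measurableW hC meta.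
have [fCm _ _] := fCE.
have fCi : sub_measurable C (fun x => (fC x)^-1) by exact: measurable_inv_pos.
pose r := 2 * p; rewrite -/r in xip *.
have r2 : 2 <= r by rewrite /r; move: p1'; lra.
have r0 : 0 < r by exact: lt_le_trans r2.
have r1 : 1 < r by move: r2; lra.
have iJ : P.-integrable setT (EFin \o (fun x => `|xi x| `^ r * (f x / fC x))).
  have := integrable_mul_Lfun p0 q0 pq gq xip.
  by under [X in P.-integrable _ (_ \o X)]eq_fun do rewrite /= mulrC.
pose J := \int[P]_x (`|xi x| `^ r * (f x / fC x)).
pose A n : set TC := [set x | `|eta x| <= n%:R] `&` [set x | (fC x)^-1 <= n%:R].
have mA n : measurable (A n).
  by apply: measurableI; rewrite -[X in measurable X]setTI;
    apply: measurable_fun_le => //; exact: measurableT_comp.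
have meta1 a : sub_measurable C (fun x => `|eta x| `^ a).
  by apply: (measurableT_comp (measurable_powR a)); exact: measurableT_comp.
pose b1 n x : R := \1_(A n) x * (eta x * `|eta x| `^ (r - 2) / fC x).
pose b2 n x : R := \1_(A n) x * (`|eta x| `^ r / fC x).
pose b3 n x : R := \1_(A n) x * `|eta x| `^ r.
have m1 n : sub_measurable C (\1_(A n)) by exact: measurable_indic.
have mb1 n : sub_measurable C (b1 n).
  apply: measurable_funM; first exact: m1.
  apply: measurable_funM; last exact: fCi.
  by apply: measurable_funM; [exact: meta|exact: meta1].
have mb2 n : sub_measurable C (b2 n).
  apply: measurable_funM; first exact: m1.
  by apply: measurable_funM; [exact: meta1|exact: fCi].
have mb3 n : sub_measurable C (b3 n).
  by apply: measurable_funM; [exact: m1|exact: meta1].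
have etapow n x a : 0 <= a -> A n x -> `|eta x| `^ a <= n%:R `^ a.
  by move=> a0 [/= ? _]; rewrite ge0_ler_powR// nnegrE.
have fCi0 x : 0 <= (fC x)^-1 by rewrite invr_ge0 ltW.
have b1M n x : `|b1 n x| <= n%:R * n%:R `^ (r - 2) * n%:R.
  rewrite /b1 indicE; case: (boolP (x \in A n)) => [/set_mem Ax|_]; last first.
    by rewrite mul0r normr0 !mulr_ge0 ?powR_ge0.
  rewrite mul1r (normrM (_ * _) (fC x)^-1) (normrM (eta x) (_ `^ _)).
  rewrite (ger0_norm (powR_ge0 _ _)) (ger0_norm (fCi0 x)).
  have [a1 a2] := Ax; apply: ler_pM => //.
  apply: ler_pM => //; rewrite ?powR_ge0//.
  by apply: etapow => //; rewrite subr_ge0.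
have b2M n x : `|b2 n x| <= n%:R `^ r * n%:R.
  rewrite /b2 indicE; case: (boolP (x \in A n)) => [/set_mem Ax|_]; last first.
    by rewrite mul0r normr0 !mulr_ge0 ?powR_ge0.
  rewrite mul1r (normrM (_ `^ _) (fC x)^-1) (ger0_norm (powR_ge0 _ _)).
  rewrite (ger0_norm (fCi0 x)).
  have [a1 a2] := Ax; apply: ler_pM => //.
  by apply: etapow => //; exact: ltW.
have b3M n x : `|b3 n x| <= n%:R `^ r.
  rewrite /b3 indicE; case: (boolP (x \in A n)) => [/set_mem Ax|_]; last first.
    by rewrite mul0r normr0 ?powR_ge0.
  rewrite mul1r (ger0_norm (powR_ge0 _ _)); apply: etapow => //; exact: ltW.
have main n : (\int[P]_x (b3 n x)%:E <= J%:E)%E.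
  have [i1 e1] := pullout_bounded (mb1 n) (b1M n) fxi_integrable kCE.
  have [i2 e2] := pullout_bounded (mb2 n) (b2M n) f_integrable fCE.
  have ib3 : P.-integrable setT (EFin \o b3 n).
    have i1' : P.-integrable setT (EFin \o (cst 1 : T -> R)).
      exact: finite_measure_integrable_cst.
    have := integrable_bounded_mul i1' (sub_measurableW hC (mb3 n)) (b3M n).
    by under [X in P.-integrable _ (_ \o X)]eq_fun do rewrite /= mulr1.
  have e1' : \int[P]_x (b1 n x * kC x) = \int[P]_x b3 n x.
    congr Rintegral; apply/funext => x.
    rewrite /b1 /b3 -[LHS]mulrA; congr (_ * _).
    by rewrite -(mul_norm_powR _ r2) /eta; ring.
  have e2' : \int[P]_x (b2 n x * fC x) = \int[P]_x b3 n x.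
    congr Rintegral; apply/funext => x.
    rewrite /b2 /b3 -[LHS]mulrA; congr (_ * _).
    by rewrite divfK// gt_eqF.
  rewrite EFin_Rintegral// lee_fin.
  suff : \int[P]_x b3 n x <= r^-1 * J + (1 - r^-1) * \int[P]_x b3 n x.
    move=> h; rewrite -(ler_pM2l (x := r^-1)) ?invr_gt0//.
    by move: h; rewrite mulrBl mul1r addrCA -lerBlDl subrr subr_ge0.
  rewrite -{1}e1' -e1 -e2' -e2 /J -!RintegralZl// -RintegralD//.
  - apply: le_Rintegral => //.
      exact: (integrableD measurableT (integrableZl measurableT _ iJ)
        (integrableZl measurableT _ i2)).
    move=> x _; rewrite /b1 /b2 indicE; case: (boolP (x \in A n)) => [_|_] /=.
      rewrite !mul1r.
      have := young_powRB2 (eta x) (xi x) r2.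
      rewrite -(ler_pM2r (x := f x / fC x)) ?divr_gt0//.
      by congr (_ <= _); ring.
    rewrite !mul0r mulr0 addr0 !mulr_ge0 ?invr_ge0 ?powR_ge0 ?ltW//.
  - exact: (integrableZl measurableT _ iJ).
  - exact: (integrableZl measurableT _ i2).
have le : (\int[P]_x (`|eta x| `^ r)%:E <= J%:E)%E.
  apply: fatou_le main.
  - by move=> n; exact: (sub_measurableW hC (mb3 n)).
  - exact: (sub_measurableW hC (meta1 r)).
  - move=> n; apply: aeW => x; apply: mulr_ge0; last exact: powR_ge0.
    by rewrite indicE ler0n.
  - apply: aeW => x; apply: cvg_near_cst.
    near=> n; rewrite /b3 indicE mem_set ?mul1r//; split => /=; near: n.
      exact: nbhs_infty_ger.
    exact: nbhs_infty_ger.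
split => //; apply/LfunP_integrable; first exact: ltW.
split => //; apply/integrableP; split.
  exact/measurable_EFinP/(sub_measurableW hC (meta1 r)).
under eq_integral do rewrite gee0_abs ?lee_fin ?powR_ge0//.
exact: le_lt_trans le (ltry _).
Unshelve. all: by end_near.
Qed.

End estimator.

(** * Densities of probability measures *)

Section densities.
Context d (T : measurableType d) (R : realType).

(** The combination of the measures has total mass 1, so it coincides with its
    normalization, which is a probability. *)
Lemma mixture_exists (Q1 Q2 : probability T R) (t : R) : 0 <= t <= 1 ->
  exists Q : probability T R, forall A, measurable A ->
    (Q A = t%:E * Q1 A + (1 - t)%:E * Q2 A)%E.
Proof.
move=> /andP[t0 t1]; have s0 : 0 <= 1 - t by rewrite subr_ge0.
pose m : {measure set T -> \bar R} :=
  measure_add (mscale (NngNum t0) Q1) (mscale (NngNum s0) Q2).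
have mE A : m A = (t%:E * Q1 A + (1 - t)%:E * Q2 A)%E.
  exact: measure_addE.
have m1 : m setT = 1%E by rewrite mE !probability_setT !mule1 -EFinD subrKC.
exists (mnormalize m Q1) => A mA.
have mN : mnormalize m Q1 = (fun U => m U * (fine (m setT))^-1%:E)%E.
  by rewrite /mnormalize m1 onee_eq0.
transitivity (m A * (fine (m setT))^-1%:E)%E.
  exact: (congr1 (fun h => h A) mN).
by rewrite m1 invr1 mule1.
Qed.

Variable P : probability T R.

Section one_density.
Variables (Q : probability T R) (QP : Q `<< P).

Lemma EFin_density :
  EFin \o density P Q = Radon_Nikodym (charge_of_finite_measure Q) P.
Proof.
by apply/funext => x; rewrite /= /density fineK// Radon_Nikodym_fin_num.
Qed.

Lemma density_integrable : P.-integrable [set: T] (EFin \o density P Q).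
Proof. by rewrite EFin_density; exact: Radon_Nikodym_integrable. Qed.

Lemma measurable_density : measurable_fun [set: T] (density P Q).
Proof. by apply/measurable_EFinP; exact: measurable_int density_integrable. Qed.

Lemma integral_density (A : set T) : measurable A ->
  Q A = (\int[P]_(x in A) (density P Q x)%:E)%E.
Proof.
move=> mA; rewrite -[LHS]/(charge_of_finite_measure Q A).
rewrite (@Radon_Nikodym_integral _ _ _ (charge_of_finite_measure Q) P A QP mA).
by apply: eq_integral => x _; rewrite -EFin_density.
Qed.

Lemma density_unique (f : T -> R) : P.-integrable [set: T] (EFin \o f) ->
  (forall A, measurable A -> Q A = (\int[P]_(x in A) (f x)%:E)%E) ->
  {ae P, forall x, f x = density P Q x}.
Proof.
move=> iff fE.
have : ae_eq P setT (EFin \o f) (EFin \o density P Q).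
  apply: integral_ae_eq => //; first exact/measurable_EFinP/measurable_density.
  by move=> A _ mA; rewrite -fE// integral_density.
by apply: filterS => x /(_ I) [].
Qed.

Lemma density_ge0 : {ae P, forall x, 0 <= density P Q x}.
Proof.
have := ae_eq_Radon_Nikodym_SigmaFinite QP measurableT.
apply: filterS => x /(_ I); rewrite -EFin_density /= => h.
by rewrite -lee_fin -h; exact: Radon_Nikodym_SigmaFinite.f_ge0.
Qed.

(** Q vanishes where its density is nonpositive, hence so does P. *)
Lemma density_gt0 : P `<< Q -> {ae P, forall x, 0 < density P Q x}.
Proof.
move=> PQ; pose A := [set x | density P Q x <= 0].
have mA : measurable A.
  rewrite -[A]setTI; apply: measurable_fun_le => //.
  exact: measurable_density.
have QA0 : Q A = 0%E.
  apply/eqP; rewrite eq_le measure_ge0 andbT integral_density//.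
  rewrite -[leRHS](integral0 P A); apply: le_integral => //.
  - by apply: integrableS density_integrable.
  - exact: integrable0.
  - by move=> x /set_mem; rewrite /A /= lee_fin.
have PA0 : P A = 0%E by move/null_content_dominatesP : PQ; exact.
have nA : {ae P, forall x, ~ A x}.
  by exists A; split => // x /= /contrapT.
by apply: filterS nA => x /negP; rewrite -ltNge.
Qed.

Variables (p q : R) (p1 : 1 < p) (q0 : 0 < q) (pq : p^-1 + q^-1 = 1).
Hypothesis fq : density P Q \in Lfun P q%:E.

(** X is integrable under Q because its absolute value has, by the change of
    variables for nonnegative functions, the same integral as the product of X
    and the density, which Hoelder bounds. *)
Lemma expectation_density (X : T -> R) : X \in Lfun P p%:E ->
  ('E_Q[X])%E = (\int[P]_x (density P Q x * X x))%:E.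
Proof.
move=> Xp; have p0 : 0 < p by exact: lt_trans p1.
have mX := Lfun_measurable Xp.
have iX : Q.-integrable [set: T] (EFin \o X).
  apply/integrableP; split; first exact/measurable_EFinP.
  have mf := measurable_density.
  have /integrableP[_] := integrable_mul_Lfun p0 q0 pq fq Xp.
  apply: le_lt_trans.
  rewrite -(Radon_Nikodym_SigmaFinite.change_of_variables QP)//; last first.
    by apply: measurableT_comp => //; exact/measurable_EFinP.
  rewrite le_eqVlt; apply/orP; left; apply/eqP; apply: ae_eq_integral => //.
  - apply: emeasurable_funM.
      by apply: measurableT_comp => //; exact/measurable_EFinP.
    exact: measurable_int (Radon_Nikodym_SigmaFinite.f_integrable QP).
  - by apply: measurableT_comp => //; exact/measurable_EFinP/measurable_funM.
  - apply: filterS2 density_ge0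
      (ae_eq_Radon_Nikodym_SigmaFinite QP measurableT).
    move=> x f0 /(_ I); rewrite -EFin_density => /= -> _.
    by rewrite normrM (ger0_norm f0) -EFinM mulrC.
rewrite unlock -(Radon_Nikodym_change_of_variables QP measurableT iX).
rewrite -EFin_Rintegral; last exact: integrable_mul_Lfun p0 q0 pq fq Xp.
by apply: eq_integral => x _; rewrite -EFin_density /= -EFinM mulrC.
Qed.
End one_density.
End densities.

(** * The dual description of the operator *)

Section density_set.
Context d (T : measurableType d) (R : realType) (P : probability T R).
Variables (p q : R) (p1 : 1 < p) (q1 : 1 <= q) (pq : p^-1 + q^-1 = 1).
Variable rho : (T -> R) -> R.
Local Notation D := (density_set P p q rho).
Local Notation Acc := (acceptance_set P p rho).

Let p0 : 0 < p. Proof. exact: lt_trans p1. Qed.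
Let p1' : 1 <= p. Proof. exact: ltW. Qed.
Let q0 : 0 < q. Proof. exact: lt_le_trans q1. Qed.

(** The penalty as a real-valued function of densities: the support function of
    the acceptance set for the bracket of L^q and L^p. It agrees with the
    extended-real penalty on the representation set ([penaltyE]). *)
Definition acceptance_support (f : T -> R) : R :=
  sup [set \int[P]_x (f x * zeta x) | zeta in Acc].
Local Notation alpha := acceptance_support.

Lemma pairing_ae_eq (f g X : T -> R) :
  measurable_fun setT f -> measurable_fun setT g -> measurable_fun setT X ->
  {ae P, forall x, f x = g x} ->
  \int[P]_x (f x * X x) = \int[P]_x (g x * X x).
Proof.
move=> mf mg mX fg; apply: ae_eq_Rintegral; try exact: measurable_funM.
by apply: filterS fg => x ->.
Qed.

Lemma acceptance_support_ae_eq (f g : T -> R) :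
  measurable_fun setT f -> measurable_fun setT g ->
  {ae P, forall x, f x = g x} -> alpha f = alpha g.
Proof.
move=> mf mg fg; congr sup; apply/seteqP; split => _ [z zA <-]; exists z => //.
- apply: pairing_ae_eq => //; first exact: Lfun_measurable zA.1.
  by apply: filterS fg => x ->.
- by apply: pairing_ae_eq => //; exact: Lfun_measurable zA.1.
Qed.

Lemma density_set_ae_eq (f g : T -> R) : measurable_fun setT g ->
  {ae P, forall x, g x = f x} -> D f -> D g.
Proof.
move=> mg gf [fq [Q QP fQ]]; split; first exact: Lfun_ae_eq gf fq.
by exists Q => //; apply: filterS2 gf fQ => x ->.
Qed.

Hypothesis rho0 : rho (fun=> 0) = 0.

Lemma acceptance0 : Acc (fun=> 0).
Proof. by split; [exact: Lfun_cst|rewrite rho0]. Qed.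

(** The penalty is at least 0, as 0 is acceptable, and finite on the
    representation set; all expectations in it are real integrals under P. *)
Lemma penaltyE (Q : probability T R) : representation_set P p q rho Q ->
  penalty P p rho Q = (alpha (density P Q))%:E /\
  has_ubound [set \int[P]_x (density P Q x * zeta x) | zeta in Acc].
Proof.
move=> [QP Qq Qy].
pose S := [set \int[P]_x (density P Q x * zeta x) | zeta in Acc].
have SE : [set ('E_Q[zeta])%E | zeta in Acc] = EFin @` S.
  apply/seteqP; split => [_ [z zA <-]|_ [_ [z zA <-] <-]].
    exists (\int[P]_x (density P Q x * z x)); first by exists z.
    by rewrite (expectation_density QP p1 q0 pq Qq zA.1).
  by exists z => //; rewrite (expectation_density QP p1 q0 pq Qq zA.1).
have S0 : S !=set0.
  exists (\int[P]_x (density P Q x * 0)); exists (fun=> 0) => //.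
  exact: acceptance0.
have hS : has_ubound S.
  move: Qy; rewrite /penalty SE => Qy.
  have [s Ss] := S0.
  have sle r : S r -> (r%:E <= ereal_sup (EFin @` S))%E.
    by move=> Sr; apply: ereal_sup_ubound; exists r.
  exists (fine (ereal_sup (EFin @` S))) => r Sr.
  rewrite -lee_fin fineK ?sle// fin_numElt Qy andbT.
  by apply: lt_le_trans (sle _ Ss); rewrite ltNyr.
split => //; rewrite /penalty SE; exact: ereal_sup_EFin.
Qed.

Lemma le_acceptance_support f zeta : D f -> Acc zeta ->
  \int[P]_x (f x * zeta x) <= alpha f.
Proof.
move=> [fq [Q QR fQ]] zA; have [QP Qq _] := QR.
have mf := Lfun_measurable fq; have mQ := Lfun_measurable Qq.
have mz := Lfun_measurable zA.1.
rewrite (pairing_ae_eq mf mQ mz fQ) (acceptance_support_ae_eq mf mQ fQ).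
by apply: ub_le_sup; [have [] := penaltyE QR|exists zeta].
Qed.

Lemma acceptance_support_le f (c : R) :
  (forall zeta, Acc zeta -> \int[P]_x (f x * zeta x) <= c) -> alpha f <= c.
Proof.
move=> h; apply: ge_sup.
  exists (\int[P]_x (f x * 0)); exists (fun=> 0) => //; exact: acceptance0.
by move=> _ [z zA <-]; exact: h.
Qed.

Section dual.
Hypothesis hdual : dual_representation P p q rho.

(** Together with [le_dual], this restates the dual representation in terms of
    densities and real numbers only. *)
Lemma dual_le f X : D f -> X \in Lfun P p%:E ->
  \int[P]_x (f x * X x) - alpha f <= rho X.
Proof.
move=> [fq [Q QR fQ]] Xp; have [QP Qq _] := QR.
have mf := Lfun_measurable fq; have mQ := Lfun_measurable Qq.
rewrite (pairing_ae_eq mf mQ (Lfun_measurable Xp) fQ).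
rewrite (acceptance_support_ae_eq mf mQ fQ).
rewrite -lee_fin hdual//; apply: ereal_sup_ubound; exists Q => //.
by rewrite (expectation_density QP p1 q0 pq Qq Xp) (penaltyE QR).1 EFinB.
Qed.

Lemma le_dual X (c : R) : X \in Lfun P p%:E ->
  (forall f, D f -> \int[P]_x (f x * X x) - alpha f <= c) -> rho X <= c.
Proof.
move=> Xp h; rewrite -lee_fin hdual//; apply: ge_ereal_sup => _ [Q QR <-].
have [QP Qq _] := QR.
rewrite (expectation_density QP p1 q0 pq Qq Xp) (penaltyE QR).1 -EFinB lee_fin.
by apply: h; split => //; exists Q => //; exact: aeW.
Qed.

(** Otherwise the supremum representing a real value of the operator would be
    that of the empty set. *)
Lemma density_set_nonempty : D !=set0.
Proof.
apply/set0P/negP => /eqP D0.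
have h : representation_set P p q rho = set0.
  apply/seteqP; split => // Q QR; have [QP Qq _] := QR.
  suff : D (density P Q) by rewrite D0.
  by split => //; exists Q => //; exact: aeW.
have := hdual (Lfun_cst P 0 p); rewrite h image_set0 ereal_sup0.
by [].
Qed.
End dual.

(** The density set is saturated under almost sure equality, so the negligible
    set where a density is not positive can be repaired. *)
Lemma density_set_pos (hproper : proper_operator P p q rho) f : D f ->
  exists2 g, D g /\ (forall x, 0 < g x) & {ae P, forall x, g x = f x}.
Proof.
move=> Df; have [fq [Q QR fQ]] := Df; have [QP PQ] := hproper _ QR.
have mf := Lfun_measurable fq.
pose g x := if f x <= 0 then 1 else f x.
have mg : measurable_fun setT g.
  by apply: measurable_fun_ifT => //; apply: measurable_fun_ler.
have gf : {ae P, forall x, g x = f x}.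
  apply: filterS2 fQ (density_gt0 QP PQ) => x fx; rewrite -fx => f0.
  by rewrite /g leNgt f0.
exists g => //; split; first exact: density_set_ae_eq gf Df.
by move=> x; rewrite /g; case: (leP (f x) 0) => // _; exact: ltr01.
Qed.

Lemma density_set_convex (hconvex : prob_convex (representation_set P p q rho))
  f g t : 0 <= t <= 1 -> D f -> D g -> D (fun x => t * f x + (1 - t) * g x).
Proof.
move=> t01 [fq [Q1 Q1R fQ1]] [gq [Q2 Q2R gQ2]].
have [Q QE] := mixture_exists Q1 Q2 t01.
have QR := hconvex _ _ _ _ Q1R Q2R t01 QE.
have [Q1P _ _] := Q1R; have [Q2P _ _] := Q2R; have [QP Qq _] := QR.
have mf := Lfun_measurable fq; have mg := Lfun_measurable gq.
pose h x := t * density P Q1 x + (1 - t) * density P Q2 x.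
have ih : P.-integrable setT (EFin \o h).
  have i1 := integrableZl measurableT t (density_integrable Q1P).
  have i2 := integrableZl measurableT (1 - t) (density_integrable Q2P).
  exact: (integrableD measurableT i1 i2).
have hQ : {ae P, forall x, h x = density P Q x}.
  apply: density_unique => // A mA; rewrite QE//.
  rewrite (integral_density Q1P mA) (integral_density Q2P mA).
  have j1 := integrableS measurableT mA (@subsetT _ _) (density_integrable Q1P).
  have j2 := integrableS measurableT mA (@subsetT _ _) (density_integrable Q2P).
  rewrite -!integralZl// -integralD//; exact: integrableZl.
apply: (density_set_ae_eq _ _ (f := density P Q)).
- by apply: measurable_funD; exact: measurable_funM.
- by apply: filterS3 fQ1 gQ2 hQ => x -> ->.
- by split => //; exists Q => //; exact: aeW.
Qed.

(** Conditional expectations depend only on the almost sure class of f, so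
    stability, stated for the Radon-Nikodym derivative, holds for every
    version. *)
Lemma density_set_stable (hstable : stable_operator P p q rho) C f fC :
  is_sub_sigma_algebra C -> D f -> is_cond_exp P C f fC ->
  (forall x, 0 < fC x) ->
  D (fun x => f x / fC x).
Proof.
move=> hC [fq [Q QR fQ]] [mfC ifC fCE] fC0; have [QP Qq _] := QR.
have mf := Lfun_measurable fq.
have QC : is_cond_exp P C (density P Q) fC.
  split => // A CA; rewrite fCE//; have mA := hC.2 _ CA.
  apply: ae_eq_integral => //.
  - exact/measurable_funTS/measurable_EFinP.
  - exact/measurable_funTS/measurable_EFinP/measurable_density.
  - by apply: filterS fQ => x -> _.
have DQ := hstable _ QR _ hC _ QC.
have mfCT := sub_measurableW hC mfC.
apply: density_set_ae_eq DQ; last by apply: filterS fQ => x ->.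
by apply: measurable_funM => //; exact: measurable_inv_pos.
Qed.
End density_set.

(** * Weak compactness and the saddle point *)

(** Brackets with elements of L^p are continuous for the weak topology, so
    asymptotic lower bounds along a sequence pass to its cluster points. *)
Lemma weakly_compact_cluster d (T : measurableType d) (R : realType)
    (P : probability T R) (p : R) (D : set (T -> R)) (u : nat -> T -> R) :
  weakly_compact P p D -> (forall n, D (u n)) ->
  exists2 f, D f & forall X c, X \in Lfun P p%:E ->
    (forall e, 0 < e ->
      \forall n \near \oo, c - e <= \int[P]_x (u n x * X x)) ->
    c <= \int[P]_x (f x * X x).
Proof.
move=> cD uD.
pose W := initial_topology (@pairing _ T R P p).
pose F : set_system W := fmap (u : nat -> W) \oo.
have [|f [Df fcl]] := cD F.
  by exists 0%N => // n _; exact: uD.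
exists f => // X c Xp h.
pose z : {zeta : T -> R | zeta \in Lfun P p%:E} := exist _ X Xp.
have cX : {for (f : W), continuous (fun g : W => pairing g z)}.
  have c1 : {for (f : W), continuous (pairing (P := P) (p := p) : W -> _)}.
    exact: initial_continuous.
  have := @proj_continuous _ (fun=> R) z (pairing f).
  exact: (continuous_comp c1).
rewrite leNgt; apply/negP => lt.
pose e := (c - \int[P]_x (f x * X x)) / 2.
have e0 : 0 < e by rewrite divr_gt0// subr_gt0.
have lte : \int[P]_x (f x * X x) < c - e by rewrite /e; lra.
have nU : nbhs (f : W) [set g : W | pairing g z < c - e].
  by apply: (cX [set r | r < c - e]); exact: lt_nbhsl.
have [g [/= g1 g2]] := fcl [set g : W | c - e <= pairing g z] _ (h e e0) nU.
by have := le_lt_trans g1 g2; rewrite ltxx.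
Qed.

Section saddle_point.
Context d (T : measurableType d) (R : realType) (P : probability T R).
Variables (p q : R) (p1 : 1 < p) (p2 : p <= 2) (q1 : 1 <= q).
Hypothesis pq : p^-1 + q^-1 = 1.
Variable rho : (T -> R) -> R.
Local Notation D := (density_set P p q rho).
Local Notation Acc := (acceptance_set P p rho).
Local Notation alpha := (acceptance_support P p rho).
Hypothesis rho0 : rho (fun=> 0) = 0.
Hypothesis hdual : dual_representation P p q rho.
Hypothesis hcompact : weakly_compact P p D.
Hypothesis hconvex : prob_convex (representation_set P p q rho).
Hypothesis hstable : stable_operator P p q rho.
Hypothesis hproper : proper_operator P p q rho.
Variables (xi : T -> R) (hxi : xi \in Lfun P (4 * p)%:E).
Variables (C : set (set T)) (hC : is_sub_sigma_algebra C).
Local Notation E := (Lsub P C (2 * p)).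

Let p0 : 0 < p. Proof. exact: lt_trans p1. Qed.
Let p1' : 1 <= p. Proof. exact: ltW. Qed.
Let q0 : 0 < q. Proof. exact: lt_le_trans q1. Qed.
Let p21 : 1 <= 2 * p. Proof. by move: p1'; lra. Qed.

Let xi2p : xi \in Lfun P (2 * p)%:E.
Proof. by apply: LfunS hxi => //; move: p0; lra. Qed.

(** The bound p <= 2 on the exponent enters here, through 2 p * p <= 4 p. *)
Let xi_pow : (fun x => `|xi x| `^ (2 * p)) \in Lfun P p%:E.
Proof.
apply: Lfun_powR => //; apply: LfunS hxi.
  by apply: (le_trans p21); rewrite ler_peMr//; move: p0; lra.
by rewrite ler_pM2r//; move: p2; lra.
Qed.

Let loss (eta : T -> R) x := (xi x - eta x) ^+ 2.

Let lossP eta : E eta -> loss eta \in Lfun P p%:E.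
Proof. by move=> [etap _]; apply: Lfun_sqr => //; exact: LfunB. Qed.

Let lagrangian (eta f : T -> R) := \int[P]_x (f x * loss eta x) - alpha f.
Local Notation L := lagrangian.

Let int_pair f X : D f -> X \in Lfun P p%:E ->
  P.-integrable [set: T] (EFin \o (fun x => f x * X x)).
Proof. by move=> [fq _]; exact: integrable_mul_Lfun p0 q0 pq fq. Qed.

Let pair_comb f g X a b : D f -> D g -> X \in Lfun P p%:E ->
  \int[P]_x ((a * f x + b * g x) * X x) =
  a * \int[P]_x (f x * X x) + b * \int[P]_x (g x * X x).
Proof.
move=> Df Dg Xp; have iF := int_pair Df Xp; have iG := int_pair Dg Xp.
rewrite -!RintegralZl// -RintegralD//.
- by congr Rintegral; apply/funext => x; rewrite mulrDl !mulrA.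
- exact: (integrableZl measurableT a iF).
- exact: (integrableZl measurableT b iG).
Qed.

Let E0 : E (fun=> 0).
Proof.
split; first exact: Lfun_cst.
exact: measurable_cst.
Qed.

Let D_int1 f : D f -> P.-integrable [set: T] (EFin \o f).
Proof.
move=> Df; have := int_pair Df (Lfun_cst P 1 p).
by under [X in P.-integrable _ (_ \o X)]eq_fun do rewrite /= mulr1.
Qed.

Let D_intxi f : D f -> P.-integrable [set: T] (EFin \o (f \* xi)).
Proof.
by move=> Df; apply: int_pair => //; apply: LfunS xi2p => //; move: p0; lra.
Qed.

Let estimator_opt f fC kC : D f -> (forall x, 0 < f x) ->
  is_cond_exp P C f fC -> (forall x, 0 < fC x) ->
  is_cond_exp P C (f \* xi) kC ->
  E (fun x => kC x / fC x) /\
  forall eta, E eta -> L (fun x => kC x / fC x) f <= L eta f.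
Proof.
move=> Df f0 fCE fC0 kCE; have [fq _] := Df.
have Eeta : E (fun x => kC x / fC x).
  apply: (estimator_Lsub hC p1 q0 pq fq f0 fCE fC0 kCE xi2p) => //.
  by have [] := density_set_stable q1 hstable hC Df fCE fC0.
split => // eta Eeta'; rewrite lerD2r.
exact: (estimator_minimal hC p1 q0 pq fq f0 fCE fC0 kCE xi2p Eeta.1 Eeta').
Qed.

Let lagrangian_ae_eq eta f g : E eta -> D f -> D g ->
  {ae P, forall x, f x = g x} ->
  L eta f = L eta g.
Proof.
move=> Eeta [fq _] [gq _] fg.
have mf := Lfun_measurable fq; have mg := Lfun_measurable gq.
rewrite /L (pairing_ae_eq mf mg (Lfun_measurable (lossP Eeta)) fg).
by rewrite (acceptance_support_ae_eq _ _ mf mg fg).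
Qed.

(** The values v such that some density f bounds L(-,f) below by v; the supremum
    S of W is the value of the dual problem. *)
Let W := [set v | exists2 f, D f & forall eta, E eta -> v <= L eta f].

Let W_sup : has_sup W.
Proof.
split.
  have [f Df] := density_set_nonempty hdual.
  have [g [Dg g0] _] := density_set_pos q1 hproper Df.
  exists (- alpha g); exists g => // eta Eeta.
  rewrite -[leLHS]add0r lerD2r; apply: Rintegral_ge0 => x _.
  by rewrite mulr_ge0 ?sqr_ge0 ?ltW.
exists (rho (loss (fun=> 0))) => v [f Df vL]; apply: le_trans (vL _ E0) _.
exact: (dual_le p1 q1 pq rho0 hdual Df (lossP E0)).
Qed.

Let S := sup W.

(** A cluster point of a maximizing sequence. The penalty is unfolded into its
    supremum over acceptable zeta, because only the brackets with the fixed
    functions (xi - eta)^2 - zeta are continuous. *)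
Let dual_maximizer : exists2 f, D f /\ (forall x, 0 < f x) &
  forall eta, E eta -> S <= L eta f.
Proof.
have /choice[u uP] : forall n : nat, exists f, D f /\
    forall eta, E eta -> S - n.+1%:R^-1 <= L eta f.
  move=> n; have [|v [f Df vf] lt] := @sup_adherent _ _ n.+1%:R^-1 _ W_sup.
    by rewrite invr_gt0.
  by exists f; split => // eta Eeta; apply: le_trans (vf _ Eeta); exact: ltW.
have [f Df fP] := weakly_compact_cluster hcompact (fun n => (uP n).1).
have fS eta : E eta -> S <= L eta f.
  move=> Eeta; rewrite lerBrDl -lerBrDr.
  apply: acceptance_support_le => // zeta zA.
  rewrite lerBrDr -lerBrDl.
  have split_pair h : D h -> \int[P]_x (h x * (loss eta x - zeta x)) =
      \int[P]_x (h x * loss eta x) - \int[P]_x (h x * zeta x).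
    move=> Dh; rewrite -RintegralB//.
    - by congr Rintegral; apply/funext => x; rewrite mulrBr.
    - exact: int_pair Dh (lossP Eeta).
    - exact: int_pair Dh zA.1.
  rewrite -split_pair//; apply: fP; first exact: LfunB (lossP Eeta) zA.1.
  move=> e e0; near=> n; have [Dn Ln] := uP n.
  rewrite split_pair//; apply: (@le_trans _ _ (S - n.+1%:R^-1)).
    rewrite lerD2l lerN2 ltW//; near: n.
    exact: (near_infty_natSinv_lt (PosNum e0)).
  apply: le_trans (Ln _ Eeta) _; rewrite /L lerD2l lerN2.
  exact: (le_acceptance_support p1 q1 pq rho0).
have [g [Dg g0] gf] := density_set_pos q1 hproper Df.
exists g => // eta Eeta; rewrite (lagrangian_ae_eq Eeta Dg Df gf); exact: fS.
Unshelve. all: by end_near.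
Qed.

(** The maximizer fh is perturbed towards f by the weights t n = 1/(n+1);
    optimality of fh bounds L(eta_n,f) by S for the perturbed estimators, and
    Fatou's lemma carries the bound to the estimator of fh. *)
Let saddle : exists2 etahat, E etahat & exists2 fhat, D fhat &
  (forall f, D f -> L etahat f <= S) /\ (forall eta, E eta -> S <= L eta fhat).
Proof.
have [fh [Dfh fh0] fhS] := dual_maximizer.
have [fhC fhCE fhC0] := cond_exp_pos_exists hC (D_int1 Dfh) fh0.
have [khC khCE] := cond_exp_exists hC (D_intxi Dfh).
have [Eh _] := estimator_opt Dfh fh0 fhCE fhC0 khCE.
pose etah x := khC x / fhC x.
exists etah => //; exists fh => //; split => // f Df.
wlog f0 : f Df / forall x, 0 < f x.
  move=> H; have [g [Dg g0] gf] := density_set_pos q1 hproper Df.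
  by rewrite -(lagrangian_ae_eq Eh Dg Df gf); exact: H.
have [fC fCE fC0] := cond_exp_pos_exists hC (D_int1 Df) f0.
have [kC kCE] := cond_exp_exists hC (D_intxi Df).
pose t (n : nat) : R := n.+1%:R^-1.
have t0 n : 0 < t n by rewrite invr_gt0.
have t1 n : t n <= 1 by rewrite invf_le1// ler1n.
have s0 n : 0 <= 1 - t n by rewrite subr_ge0.
pose mix (a b : T -> R) n x := t n * a x + (1 - t n) * b x.
have mix0 a b n : (forall x, 0 < a x) -> (forall x, 0 < b x) ->
    forall x, 0 < mix a b n x.
  by move=> a0 b0 x; rewrite ltr_pwDl ?mulr_gt0// mulr_ge0// ltW.
have Dn n : D (mix f fh n).
  by apply: density_set_convex => //; rewrite t1 ltW.
have fnCE n :=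
  cond_exp_comb hC (t n) (1 - t n) (D_int1 Df) (D_int1 Dfh) fCE fhCE.
have knCE n : is_cond_exp P C (mix f fh n \* xi) (mix kC khC n).
  have := cond_exp_comb hC (t n) (1 - t n)
    (D_intxi Df) (D_intxi Dfh) kCE khCE.
  congr is_cond_exp; apply/funext => x; rewrite /mix /=; ring.
pose eta n x := mix kC khC n x / mix fC fhC n x.
have Sn n : E (eta n) /\ L (eta n) (mix f fh n) <= S.
  have [En min] := estimator_opt (Dn n) (mix0 _ _ n f0 fh0)
    (fnCE n) (mix0 _ _ n fC0 fhC0) (knCE n).
  split => //; apply: ub_le_sup; first by case: W_sup.
  by exists (mix f fh n).
have LS n : L (eta n) f <= S.
  have [En Ln] := Sn n; have lossn := lossP En.
  have alphan : alpha (mix f fh n) <= t n * alpha f + (1 - t n) * alpha fh.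
    apply: acceptance_support_le => // zeta zA.
    rewrite (pair_comb _ _ Df Dfh zA.1).
    by apply: lerD; rewrite ler_wpM2l ?(ltW (t0 n))//;
      apply: (le_acceptance_support p1 q1 pq rho0).
  have Lmix :
      t n * L (eta n) f + (1 - t n) * L (eta n) fh <= L (eta n) (mix f fh n).
    rewrite /L (pair_comb _ _ Df Dfh lossn) !mulrBr addrACA lerD2l.
    by rewrite -opprD lerN2.
  have := le_trans Lmix Ln; have := fhS _ En.
  move: (L (eta n) f) (L (eta n) fh) (t0 n) (s0 n) => a b tn sn h1 h2.
  rewrite -(ler_pM2l tn); have := ler_wpM2l sn h1; move: h2; lra.
have le : (\int[P]_x (f x * loss etah x)%:E <= (S + alpha f)%:E)%E.
  apply: (@fatou_le _ _ _ P (fun n x => f x * loss (eta n) x)).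
  - move=> n; apply/measurable_EFinP.
    exact: measurable_int (int_pair Df (lossP (Sn n).1)).
  - by apply/measurable_EFinP; exact: measurable_int (int_pair Df (lossP Eh)).
  - by move=> n; apply: aeW => x; rewrite mulr_ge0 ?sqr_ge0// ltW.
  - apply: aeW => x; apply: cvgM; first exact: cvg_cst.
    have mixcvg a b : mix a b ^~ x @ \oo --> b x.
      have h := cvg_harmonic (R := R).
      have := cvgD (cvgM h (cvg_cst (a x)))
        (cvgM (cvgB (cvg_cst (1 : R)) h) (cvg_cst (b x))).
      by rewrite mul0r subr0 mul1r add0r; apply.
    have etacvg : eta ^~ x @ \oo --> etah x.
      apply: cvgM; first exact: mixcvg.
      by apply: cvgV; [rewrite gt_eqF|exact: mixcvg].
    rewrite /loss; under eq_fun do rewrite expr2; rewrite expr2.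
    by apply: cvgM; apply: cvgB => //; exact: cvg_cst.
  - move=> n; have := LS n; rewrite /L lerBlDr.
    by rewrite EFin_Rintegral ?lee_fin//; exact: int_pair Df (lossP (Sn n).1).
move: le; rewrite EFin_Rintegral ?lee_fin; last exact: int_pair Df (lossP Eh).
by rewrite /L lerBlDr.
Qed.

Lemma minimizer_exists : exists2 etahat, E etahat &
  forall eta, E eta -> rho (loss etahat) <= rho (loss eta).
Proof.
have [etah Eh [fh Dfh [hle hge]]] := saddle.
exists etah => // eta Eeta; apply: (@le_trans _ _ S).
  exact: (le_dual p1 q1 pq rho0 hdual (lossP Eh)).
apply: le_trans (hge _ Eeta) _.
exact: (dual_le p1 q1 pq rho0 hdual Dfh (lossP Eeta)).
Qed.
End saddle_point.

Unset Implicit Arguments.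
Set Strict Implicit.

Theorem theorem4p17 (R : realType) (d : measure_display)
    (T : measurableType d) (P : probability T R)
    (p q : R) (hp : 1 < p <= 2) (hpq : p^-1 + q^-1 = 1)
    (rho : (T -> R) -> R) (hrho : convex_operator P p rho)
    (hdual : dual_representation P p q rho)
    (hbounded : norm_bounded P q (density_set P p q rho))
    (hcompact : weakly_compact P p (density_set P p q rho))
    (hconvex : prob_convex (representation_set P p q rho))
    (hstable : stable_operator P p q rho) (hproper : proper_operator P p q rho)
    (xi : T -> R) (hxi : xi \in Lfun P (4 * p)%:E)
    (C : set (set T)) (hC : is_sub_sigma_algebra C) :
  exists2 etahat : T -> R, Lsub P C (2 * p) etahat &
    rho (fun x => (xi x - etahat x) ^+ 2) =
      inf [set rho (fun x => (xi x - eta x) ^+ 2) | eta in Lsub P C (2 * p)].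
Proof.
have /andP[p1 p2] := hp.
have q1 : 1 <= q.
  have pi0 : 0 < p^-1 by rewrite invr_gt0 (lt_trans _ p1).
  have pi1 : p^-1 < 1 by rewrite invf_lt1 // (lt_trans _ p1).
  have qi : 0 < q^-1 by move: hpq; lra.
  rewrite -[q]invrK invf_ge1//; move: hpq; lra.
have rho0 := convex_operator_normalized hrho.
have [etah Eh min] := minimizer_exists p1 p2 q1 hpq rho0 hdual hcompact hconvex
  hstable hproper hxi hC.
exists etah => //; apply/eqP; rewrite eq_le; apply/andP; split.
  apply: lb_le_inf; first by exists (rho (fun x => (xi x - etah x) ^+ 2)), etah.
  by move=> _ [eta Eeta <-]; exact: min.
apply: ge_inf; last by exists etah.
exists (rho (fun x => (xi x - etah x) ^+ 2)) => _ [eta Eeta <-]; exact: min.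
Qed.
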